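(* Let $N\ge 1$, let $p_c:=\frac{2N}{N+1}<p\le 2$ and $0<q<p-1$. Let $u_0\in W^{1,\infty}(\mathbb{R}^N)$ satisfy $u_0\ge 0$, $u_0\not\equiv 0$, and assume that $u_0$ is compactly supported. Let $u$ be the solution to $\partial_t u-\Delta_p u+|\nabla u|^q=0$ in $(0,\infty)\times\mathbb{R}^N$ with $u(0)=u_0$, and let $\mathcal{P}(t):=\{x\in\mathbb{R}^N:\ u(t,x)>0\}$. Then there exists $R>0$ such that $$\mathcal{P}(t)\subseteq B(0,R)\qquad\text{for any } t\ge 0.$$
   Context: $\Delta_p u=\mathrm{div}(|\nabla u|^{p-2}\nabla u)$. For $p\in(p_c,2]$, $q>0$ and $u_0\in W^{1,\infty}(\mathbb{R}^N)$ with $u_0\ge0$, $u_0\not\equiv0$, it is known that the Cauchy problem $\partial_t u-\Delta_p u+|\nabla u|^q=0$ in $(0,\infty)\times\mathbb{R}^N$, $u(0)=u_0$, has a unique nonnegative viscosity solution $u\in\mathcal{BC}([0,\infty)\times\mathbb{R}^N)\cap L^\infty(0,\infty;W^{1,\infty}(\mathbb{R}^N))$ ($\mathcal{BC}$: bounded continuous functions), which is also a weak solution if $p<2$ and a classical solution if $p=2$, and satisfies $0\le u\le\|u_0\|_\infty$. ''The solution'' means this one. $B(x,r)$ denotes the ball of center $x$ and radius $r$. *)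

(* Defs.v *)
From HB Require Import structures.
From mathcomp Require Import all_boot all_order all_algebra.
From mathcomp Require Import all_classical all_reals all_analysis.

Set Implicit Arguments.
Unset Strict Implicit.
Unset Printing Implicit Defensive.

Import Order.TTheory GRing.Theory Num.Theory.
Import numFieldNormedType.Exports.

Local Open Scope classical_set_scope.
Local Open Scope ring_scope.

(* R^N is 'rV[R]_N.  The library's norm on row vectors is the sup norm, which
   gives the usual topology; lengths and balls are Euclidean, through [enorm]. *)

(* The library puts the product (Borel) sigma-algebra on n.-tuple R and none on
   'rV[R]_n, so Lebesgue measure lives on tuples, and a function on R^n is
   composed with [row_of_tuple] before being integrated. *)

Section LebesgueMeasureTuple.
Context {R : realType}.
Local Notation RR := (measurableTypeR R).
Local Open Scope ereal_scope.

Definition tcons n (z : RR * n.-tuple RR) : n.+1.-tuple RR :=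
  [tuple of z.1 :: z.2].

Lemma measurable_tcons n : measurable_fun setT (@tcons n).
Proof. exact: measurable_cons. Qed.

Section step.
Variables (n : nat) (m : {sigma_finite_measure set (n.-tuple RR) -> \bar R}).

Definition lebesgue_step : set (n.+1.-tuple RR) -> \bar R :=
  pushforward (@lebesgue_measure R \x m) (@tcons n).

Let measurable_pre A : measurable A -> measurable (@tcons n @^-1` A).
Proof.
by move=> mA; rewrite -[X in measurable X]setTI; exact: measurable_tcons.
Qed.

Let step0 : lebesgue_step set0 = 0.
Proof. by rewrite /lebesgue_step /pushforward preimage_set0 measure0. Qed.

Let step_ge0 A : 0 <= lebesgue_step A.
Proof. by rewrite /lebesgue_step /pushforward; exact: measure_ge0. Qed.

Let step_sigma_additive : semi_sigma_additive lebesgue_step.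
Proof.
move=> F mF tF mUF; rewrite /lebesgue_step /pushforward preimage_bigcup.
apply: measure_semi_sigma_additive.
- by move=> i; exact: measurable_pre.
- apply/trivIsetP => /= i j _ _ ij; rewrite -preimage_setI.
  by move/trivIsetP : tF => /(_ _ _ _ _ ij) ->//; rewrite preimage_set0.
- by rewrite -preimage_bigcup; exact: measurable_pre.
Qed.

HB.instance Definition _ := isMeasure.Build _ _ _ lebesgue_step
  step0 step_ge0 step_sigma_additive.

Let step_sigma_finite : sigma_finite setT lebesgue_step.
Proof.
have /sigma_finiteP[F [FT ndF Foo]] := sigma_finiteT (@lebesgue_measure R).
have /sigma_finiteP[G [GT ndG Goo]] := sigma_finiteT m.
pose unc (t : n.+1.-tuple RR) : RR * n.-tuple RR := (thead t, [tuple of behead t]).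
have unc_m : measurable_fun setT unc.
  apply/measurable_fun_pair; first exact: measurable_tnth.
  exact: measurable_behead.
have uncK z : unc (tcons z) = z.
  by case: z => x t; rewrite /unc theadE; congr pair; exact/val_inj.
exists (fun i => unc @^-1` (F i `*` G i)).
  rewrite -preimage_bigcup; apply/esym/seteqP; split=> // t _ /=.
  have [i _ Fi] : (\bigcup_i F i) (unc t).1 by rewrite -FT.
  have [j _ Gj] : (\bigcup_i G i) (unc t).2 by rewrite -GT.
  exists (maxn i j) => //; split.
    by move: Fi; exact/subsetPset/ndF/leq_maxl.
  by move: Gj; exact/subsetPset/ndG/leq_maxr.
move=> i; have [mF Fi] := Foo i; have [mG Gi] := Goo i; split.
  by rewrite -[X in measurable X]setTI; apply: unc_m => //; exact: measurableX.
rewrite /lebesgue_step /pushforward -comp_preimage.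
rewrite (_ : unc \o _ = id); last exact/funext.
by rewrite preimage_id product_measure1E// lte_mul_pinfty// ge0_fin_numE.
Qed.

HB.instance Definition _ := Measure_isSigmaFinite.Build _ _ _ lebesgue_step
  step_sigma_finite.

End step.

Fixpoint lebesgue_tuple (n : nat) :
    {sigma_finite_measure set (n.-tuple RR) -> \bar R} :=
  match n with
  | 0 => dirac [tuple]
  | n'.+1 => lebesgue_step (lebesgue_tuple n')
  end.

End LebesgueMeasureTuple.

Section SpaceCalculus.
Context {R : realType}.

(* Functions of class C^k on an open set [D]: every iterated directional
   derivative of order at most [k] exists and is continuous on [D]. *)
Fixpoint Ck (E : normedModType R) (k : nat) (D : set E) (f : E -> R) : Prop :=
  (forall x, D x -> {for x, continuous f}) /\
  match k with
  | 0 => True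
  | k'.+1 => forall v,
      (forall x, D x -> derivable f x v) /\ Ck k' D (fun x => 'D_v f x)
  end.

Context {N : nat}.
Implicit Types (f : 'rV[R]_N -> R) (x : 'rV[R]_N) (i : 'I_N).

Definition enorm x : R := Num.sqrt (\sum_i x 0 i ^+ 2).

Definition eball x (r : R) : set 'rV[R]_N := [set y | enorm (y - x) < r].

Definition partial i f x : R := 'D_(delta_mx 0 i) f x.

Definition grad f x : 'rV[R]_N := \row_i partial i f x.

(* div (|grad f|^(p-2) grad f).  It is only used at points where grad f does
   not vanish, or for p = 2; in the latter case 0 `^ 0 = 1 makes it the
   Laplacian of f. *)
Definition plaplacian (p : R) f x : R :=
  \sum_i partial i (fun y => enorm (grad f y) `^ (p - 2) * grad f y 0 i) x.

Definition compactly_supported f : Prop :=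
  compact (closure [set x | f x != 0]).

End SpaceCalculus.

Section Sobolev.
Context {R : realType} {N : nat}.
Implicit Types (f g phi : 'rV[R]_N -> R) (C : R).

Definition row_of_tuple (t : N.-tuple (measurableTypeR R)) : 'rV[R]_N :=
  \row_i tnth t i.

Definition int_space f : R := (\int[lebesgue_tuple N]_t f (row_of_tuple t))%R.

Definition test_function phi : Prop :=
  (forall k, Ck k setT phi) /\ compactly_supported phi.

Definition weak_partial (i : 'I_N) f g : Prop :=
  forall phi, test_function phi ->
    int_space (fun x => f x * partial i phi x) =
    - int_space (fun x => g x * phi x).

Definition Linfty_le C f : Prop :=
  measurable_fun setT (f \o row_of_tuple) /\
  (Lnorm (lebesgue_tuple N) +oo (EFin \o (f \o row_of_tuple)) <= C%:E)%E.

(* f and its weak partial derivatives are bounded by C in L^infinity(R^N). *)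
Definition W1infty_le C f : Prop :=
  Linfty_le C f /\
  forall i, exists2 g, Linfty_le C g & weak_partial i f g.

Definition W1infty f : Prop := exists C, W1infty_le C f.

End Sobolev.

Section Viscosity.
Context {R : realType} {N : nat}.
Variables p q : R.
Implicit Types (psi : R * 'rV[R]_N -> R) (u : R -> 'rV[R]_N -> R).

Definition Qinfty : set (R * 'rV[R]_N) := [set z | 0 < z.1].

Definition dt psi (z : R * 'rV[R]_N) : R := derive1 (fun s => psi (s, z.2)) z.1.

Definition gradx psi (z : R * 'rV[R]_N) : 'rV[R]_N :=
  grad (fun y => psi (z.1, y)) z.2.

Definition plapx psi (z : R * 'rV[R]_N) : R :=
  plaplacian p (fun y => psi (z.1, y)) z.2.

(* For p < 2 the equation is singular where the gradient vanishes, and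
   viscosity solutions are those of Ishii-Souganidis and Ohnuma-Sato: test
   functions must be flat enough at their critical points, as measured by the
   functions of the class F below. *)

(* F: the f in C^2([0, oo)) with f(0) = f'(0) = f''(0) = 0, f'' > 0 on (0, oo)
   and |f'|^(p-2) f'' -> 0 at 0.  Only the values on [0, oo) are used; since
   such an f extends by 0 to a C^2 function on R, f is taken C^2 on R. *)
Definition class_F (f : R -> R) : Prop :=
  [/\ Ck 2 setT f,
      [/\ f 0 = 0, derive1 f 0 = 0 & derive1n 2 f 0 = 0],
      (forall r, 0 < r -> 0 < derive1n 2 f r) &
      `|derive1 f r| `^ (p - 2) * derive1n 2 f r @[r --> 0^'+] --> 0].

Definition flat_at psi (z0 : R * 'rV[R]_N) : Prop :=
  exists (delta : R) (f omega : R -> R),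
    [/\ 0 < delta, class_F f,
        [/\ {within `[0, +oo[, continuous omega},
            (forall r, 0 <= r -> 0 <= omega r) &
            omega r / r @[r --> 0^'+] --> 0] &
        forall z, Qinfty z -> enorm (z.2 - z0.2) + `|z.1 - z0.1| < delta ->
          `|psi z - psi z0 - dt psi z0 * (z.1 - z0.1)| <=
            f (enorm (z.2 - z0.2)) + omega `|z.1 - z0.1|].

Definition admissible psi : Prop :=
  Ck 2 Qinfty psi /\
  (p < 2 -> forall z0, Qinfty z0 -> gradx psi z0 = 0 -> flat_at psi z0).

(* The operator Delta_p psi - |grad psi|^q at z, with the value 0 prescribed
   at critical points in the singular range p < 2. *)
Definition rhs psi z : R :=
  if (p < 2) && (gradx psi z == 0) then 0
  else plapx psi z - enorm (gradx psi z) `^ q.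

Definition viscosity_subsolution u : Prop :=
  forall psi z0, admissible psi -> Qinfty z0 -> u z0.1 z0.2 = psi z0 ->
    (forall z, Qinfty z -> z <> z0 -> u z.1 z.2 < psi z) ->
    dt psi z0 <= rhs psi z0.

Definition viscosity_supersolution u : Prop :=
  forall psi z0, admissible psi -> Qinfty z0 -> u z0.1 z0.2 = psi z0 ->
    (forall z, Qinfty z -> z <> z0 -> psi z < u z.1 z.2) ->
    rhs psi z0 <= dt psi z0.

Definition viscosity_solution u : Prop :=
  viscosity_subsolution u /\ viscosity_supersolution u.

(* u belongs to BC([0, oo) x R^N). *)
Definition bounded_continuous u : Prop :=
  {within [set z : R * 'rV[R]_N | 0 <= z.1], continuous (fun z => u z.1 z.2)} /\
  exists M : R, forall t x, 0 <= t -> `|u t x| <= M.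

(* u belongs to L^infinity(0, oo; W^{1,infinity}(R^N)). *)
Definition Linfty_W1infty u : Prop :=
  exists C : R, {ae (@lebesgue_measure R), forall t, 0 < t -> W1infty_le C (u t)}.

(* The nonnegative viscosity solution of
   u_t - Delta_p u + |grad u|^q = 0, u(0) = u0, in its uniqueness class. *)
Definition is_solution (u0 : 'rV[R]_N -> R) u : Prop :=
  [/\ bounded_continuous u, Linfty_W1infty u,
      (forall t x, 0 <= t -> 0 <= u t x),
      viscosity_solution u &
      u 0 =1 u0].

Definition positivity_set u (t : R) : set 'rV[R]_N := [set x | 0 < u t x].

End Viscosity.

(* Main.v *)
Require Import Defs.
From HB Require Import structures.
From mathcomp Require Import all_boot all_order all_algebra.
From mathcomp Require Import all_classical all_reals all_analysis.
From mathcomp Require Import ring lra.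

Set Implicit Arguments.
Unset Strict Implicit.
Unset Printing Implicit Defensive.

Import Order.TTheory GRing.Theory Num.Theory.
Import numFieldNormedType.Exports.

Local Open Scope classical_set_scope.
Local Open Scope ring_scope.

(** Why the positivity set stays bounded: when q < p - 1 the absorption term
    dominates the diffusion near small gradients, so the stationary equation
    has supersolutions that are positive except at a single point. Fix a point
    y and an integer m with (2m - 1)(p - 1 - q) >= 1, and consider
    C |x - y|^(2m). Its p-Laplacian is of order |x - y|^((2m-1)(p-1)-1) and
    its absorption term of order |x - y|^((2m-1)q), a power that is no larger,
    so that absorption can prevail near y. Put C = M / L^(2m), where M bounds u:
    the powers of L balance in such a way ([absorption_scale]) that for L large
    absorption prevails on the whole ball of radius L around y. If u0 vanishes
    in that ball, then u0 <= C |x - y|^(2m) everywhere, comparison gives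
    u(t, x) <= C |x - y|^(2m), and at x = y this says u(t, y) = 0 for every t.
    This applies to every y whose distance to the support of u0 is at least L,
    and L does not depend on y.

    The comparison ([subsolution_vanishes]) works directly with the definition
    of a viscosity subsolution. Adding a small slope kappa t makes
    w = u - C |x - y|^(2m) - kappa t nonpositive outside a compact set, so if
    u(t, y) > 0 somewhere then w attains a positive maximum at some (t0, x0)
    with t0 > 0. The definition asks for a test function touching u strictly,
    and for p < 2 a test function must moreover be flat at all its critical
    points, which excludes generic penalizations. Strict convexity of
    |.|^(2m) provides one of the same shape: with y' the midpoint of x0 and y
    and b = C 4^m / 2,
      C |x - y|^(2m) <= b |x - y'|^(2m) + b |x0 - y'|^(2m)
    with equality only at x = x0 ([sqnorm_exp_convex]). The right-hand side
    has y' as its only critical point, where it is flat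
    ([barrier_admissible]), and it still is a supersolution where it matters
    ([rhs_barrier_le0]). The subsolution inequality then reads
    kappa <= 0. *)

(** * Polynomial functions on normed spaces *)

Section PolynomialFunctions.
Context {R : realType} {E : normedModType R}.
Implicit Types f g : E -> R.

(** All test functions below are polynomials in the coordinates. This class is
    closed under directional derivatives, which gives C^k regularity for every
    k by induction. *)
Inductive polyfun : (E -> R) -> Prop :=
| polyfun_cst c : polyfun (fun=> c)
| polyfun_lin (l : E -> R^o) : linear l -> continuous l -> polyfun l
| polyfun_add f g : polyfun f -> polyfun g -> polyfun (fun x => f x + g x)
| polyfun_mul f g : polyfun f -> polyfun g -> polyfun (fun x => f x * g x).

Lemma eq_polyfun f g : f =1 g -> polyfun f -> polyfun g.
Proof. by move=> /funext ->. Qed.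

Lemma polyfun_derive f : polyfun f ->
  (forall x, differentiable f x) /\ forall v, polyfun (fun x => 'D_v f x).
Proof.
elim=> [c|l ll cl|{}f g pf [df Df] pg [dg Dg]|{}f g pf [df Df] pg [dg Dg]].
- split=> [x|v]; first exact: differentiable_cst.
  apply: eq_polyfun (polyfun_cst 0) => x.
  by rewrite derive_cst.
- pose L : {linear E -> R^o} := HB.pack l (GRing.isLinear.Build _ _ _ _ _ ll).
  have dL x : differentiable l x by exact: (@linear_differentiable _ _ _ L).
  split=> [//|v]; apply: eq_polyfun (polyfun_cst (l v)) => x.
  by rewrite deriveE// (@diff_lin _ _ _ L).
- split=> [x|v]; first exact: differentiableD.
  apply: eq_polyfun (polyfun_add (Df v) (Dg v)) => x.
  by rewrite deriveD//; exact: diff_derivable.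
- split=> [x|v]; first exact: differentiableM.
  apply: eq_polyfun
    (polyfun_add (polyfun_mul pf (Dg v)) (polyfun_mul pg (Df v))).
  by move=> x; rewrite deriveM//; exact: diff_derivable.
Qed.

Lemma polyfun_Ck k (D : set E) f : polyfun f -> Ck k D f.
Proof.
elim: k f => [|k IH] f pf; (split;
  first by move=> x _; apply: differentiable_continuous; apply (polyfun_derive pf).1).
  by [].
move=> v; split; first by move=> x _; apply: diff_derivable; apply (polyfun_derive pf).1.
by apply: IH; apply (polyfun_derive pf).2.
Qed.

Lemma polyfun_continuous f : polyfun f -> continuous f.
Proof.
by move=> pf x; apply: differentiable_continuous; apply (polyfun_derive pf).1.
Qed.

Lemma polyfun_exp f n : polyfun f -> polyfun (fun x => f x ^+ n).
Proof.
move=> pf; elim: n => [|n IH]; first exact: (polyfun_cst 1).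
by apply: eq_polyfun (polyfun_mul pf IH) => x; rewrite exprS.
Qed.

Lemma polyfun_sum (I : finType) (F : I -> E -> R) :
  (forall i, polyfun (F i)) -> polyfun (fun x => \sum_i F i x).
Proof.
move=> pF; elim: (index_enum I) => [|i s IH].
  by apply: eq_polyfun (polyfun_cst 0) => x; rewrite big_nil.
by apply: eq_polyfun (polyfun_add (pF i) IH) => x; rewrite big_cons.
Qed.

End PolynomialFunctions.

Lemma polyfun_comp_linear {R : realType} {E F : normedModType R}
    (l : E -> F) (f : F -> R) :
  linear l -> continuous l -> polyfun f -> polyfun (fun x => f (l x)).
Proof.
move=> ll cl; elim=> [c|k lk ck|{}f g _ pf _ pg|{}f g _ pf _ pg].
- exact: polyfun_cst.
- apply: (@polyfun_lin _ _ (fun x => k (l x))).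
    by move=> a u v; rewrite ll lk.
  by move=> x; apply: continuous_comp; [exact: cl|exact: ck].
- exact: polyfun_add.
- exact: polyfun_mul.
Qed.

(** * The squared Euclidean norm *)

Section SquaredDistance.
Context {R : realType} {N : nat}.
Implicit Types (x y v w : 'rV[R]_N) (s r b : R).

Definition sqnorm x : R := \sum_i x 0 i ^+ 2.

Lemma sqnorm_ge0 x : 0 <= sqnorm x.
Proof. by apply: sumr_ge0 => i _; exact: sqr_ge0. Qed.

Lemma sqnorm_eq0 x : (sqnorm x == 0) = (x == 0).
Proof.
apply/eqP/eqP => [x0|->]; last first.
  by rewrite /sqnorm big1// => i _; rewrite mxE expr0n.
apply/rowP => i; rewrite mxE; apply/eqP; rewrite -sqrf_eq0.
by apply/eqP; apply: (psumr_eq0P _ x0) => // j _; exact: sqr_ge0.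
Qed.

Lemma sqnormZ s x : sqnorm (s *: x) = s ^+ 2 * sqnorm x.
Proof.
by rewrite /sqnorm mulr_sumr; apply: eq_bigr => i _; rewrite mxE exprMn.
Qed.

Lemma sqnorm_parallelogram v w :
  sqnorm (v + w) + sqnorm (v - w) = 2 * (sqnorm v + sqnorm w).
Proof.
rewrite /sqnorm -!big_split/= mulr_sumr; apply: eq_bigr => i _.
by rewrite !mxE; ring.
Qed.

Lemma enormE x : enorm x = Num.sqrt (sqnorm x).
Proof. by []. Qed.

Lemma enorm_sqr x : enorm x ^+ 2 = sqnorm x.
Proof. by rewrite enormE sqr_sqrtr ?sqnorm_ge0. Qed.

Lemma enorm_ge0 x : 0 <= enorm x.
Proof. exact: sqrtr_ge0. Qed.

Lemma enormZ s x : enorm (s *: x) = `|s| * enorm x.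
Proof. by rewrite !enormE sqnormZ sqrtrM ?sqr_ge0// sqrtr_sqr. Qed.

Lemma polyfun_sqdist y : polyfun (fun x => sqnorm (x - y)).
Proof.
apply: polyfun_sum => i; apply: polyfun_exp.
have pc : polyfun (fun x => x 0 i).
  apply: (@polyfun_lin _ _ (fun x : 'rV[R]_N => x 0 i : R^o)).
    by move=> a u v; rewrite !mxE.
  exact: coord_continuous.
by apply: eq_polyfun (polyfun_add pc (polyfun_cst (- y 0 i))) => x; rewrite !mxE.
Qed.

End SquaredDistance.

(** * Derivatives of radial functions *)

Section RadialCalculus.
Context {R : realType} {N : nat}.
Implicit Types (x y v w : 'rV[R]_N) (f : 'rV[R]_N -> R).

(** Directional derivatives are derivatives along lines; the one-variable chain
    rule and power rules thus become available on R^N. *)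
Lemma is_derive_lineP f x v df :
  is_derive x v f df <-> is_derive (0 : R) 1 (fun h : R => f (h *: v + x)) df.
Proof.
have E : 'D_v f x = 'D_1 (fun h : R => f (h *: v + x)) 0.
  rewrite /derive; set g1 := fun h => _; set g2 := fun h => _.
  suff -> : g1 = g2 by [].
  by apply/funext => h; rewrite /g1 /g2 /= addr0 scale0r add0r [_%:A]mulr1.
split=> -[dfl dfE].
  by apply: DeriveDef; [exact: (derivable1P f x v).1 | rewrite -E].
by apply: DeriveDef; [exact: (derivable1P f x v).2 | rewrite E].
Qed.

Lemma is_derive_comp f (g : R -> R) x v df dg :
  is_derive (f x) 1 g dg -> is_derive x v f df ->
  is_derive x v (fun z => g (f z)) (dg * df).
Proof.
move=> gf /is_derive_lineP fl; apply/is_derive_lineP.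
apply: (@is_derive1_comp _ g (fun h : R => f (h *: v + x))) fl.
by rewrite scale0r add0r.
Qed.

Lemma is_derive_sqdist x y i :
  is_derive x (delta_mx 0 i) (fun z => sqnorm (z - y)) (2 * (x - y) 0 i).
Proof.
apply/is_derive_lineP.
rewrite (_ : (fun h : R => _) =
    (id ^+ 2 + (2 * (x - y) 0 i) *: id + cst (sqnorm (x - y)) : R -> R)).
  move: ((x - y) 0 i) (sqnorm _) => d s.
  apply: (is_derive_eq (is_deriveD (is_deriveD (is_deriveX 2 (is_derive_id _ _))
    (is_deriveZ _ (is_derive_id _ _))) (is_derive_cst _ _ _))).
  by rewrite expr1 mulr0 scale0r add0r addr0 /GRing.scale /= mulr1.
apply/funext => h; rewrite !fctE.
rewrite /sqnorm (bigD1 i)//= [in RHS](bigD1 i)//=.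
rewrite (eq_bigr (fun j => (x - y) 0 j ^+ 2)).
  rewrite !mxE !eqxx /= /GRing.scale /=; ring.
by move=> j ji; rewrite !mxE (negbTE ji) andbF /= mulr0 add0r.
Qed.

Lemma is_derive_coord x y i :
  is_derive x (delta_mx 0 i) (fun z => (z - y) 0 i) 1.
Proof.
apply/is_derive_lineP.
rewrite (_ : (fun h : R => _) = id + cst ((x - y) 0 i) :> (R -> R)).
  apply: (is_derive_eq (is_deriveD (is_derive_id _ _) (is_derive_cst _ _ _))).
  by rewrite addr0.
by apply/funext => h; rewrite !fctE !mxE !eqxx /=; ring.
Qed.

Lemma divergence_radial (g : R -> R) dg x y :
  is_derive (sqnorm (x - y)) 1 g dg ->
  \sum_i partial i (fun z => g (sqnorm (z - y)) * (z - y) 0 i) x =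
  N%:R * g (sqnorm (x - y)) + 2 * sqnorm (x - y) * dg.
Proof.
move=> Dg.
rewrite (eq_bigr (fun i =>
    g (sqnorm (x - y)) + 2 * dg * (x - y) 0 i ^+ 2)); last first.
  move=> i _; rewrite /partial.
  have [_ ->] := is_deriveM (is_derive_comp (f := fun z => sqnorm (z - y)) Dg
    (is_derive_sqdist x y i))
    (is_derive_coord x y i).
  by rewrite /GRing.scale /=; ring.
rewrite big_split /= sumr_const card_ord -mulr_sumr mulr_natl.
by rewrite /sqnorm; ring.
Qed.

Lemma is_derive1_expn n (s : R) :
  is_derive s 1 (fun t : R => t ^+ n) (n%:R * s ^+ n.-1).
Proof.
apply: DeriveDef; first exact: exprn_derivable.
by rewrite exp_derive /GRing.scale /= mulr1.
Qed.

Lemma grad_sqdist_exp (a b : R) m x y :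
  grad (fun z => a + b * sqnorm (z - y) ^+ m) x =
  (2 * m%:R * b * sqnorm (x - y) ^+ m.-1) *: (x - y).
Proof.
apply/rowP => i; rewrite !mxE /partial.
have Dg (s : R) : is_derive s 1 (fun s : R => a + b * s ^+ m) (b * (m%:R * s ^+ m.-1)).
  have D := is_deriveD (is_derive_cst (a : R) s 1) (is_deriveZ b (is_derive1_expn m s)).
  by apply: (is_derive_eq D); rewrite add0r.
have [_ ->] := is_derive_comp (f := fun z => sqnorm (z - y)) (Dg _)
  (is_derive_sqdist x y i).
by rewrite !mxE; ring.
Qed.

End RadialCalculus.

(** * The p-Laplacian of a power of the distance *)

Section PLaplacian.
Context {R : realType} {N : nat}.
Implicit Types (x y z : 'rV[R]_N) (a b p : R) (m : nat).

Lemma enorm_grad_sqdist_exp a b m x y : 0 <= b -> (0 < m)%N ->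
  enorm (grad (fun z => a + b * sqnorm (z - y) ^+ m) x) =
  (2 * m%:R * b) * sqnorm (x - y) `^ (m%:R - 2^-1).
Proof.
move=> b0 m0; rewrite grad_sqdist_exp enormZ ger0_norm; last first.
  by rewrite !mulr_ge0 ?ler0n ?exprn_ge0 ?sqnorm_ge0.
rewrite -[LHS]mulrA; congr (_ * _); rewrite enormE.
have m1 : m.-1%:R = m%:R - 1 :> R by rewrite -subn1 natrB.
have m2 : 2^-1 < m%:R :> R.
  by rewrite (lt_le_trans (y := 1))// ?ler1n//; lra.
have [->|s0] := eqVneq (sqnorm (x - y)) 0.
  by rewrite sqrtr0 mulr0 powR0// subr_eq0 gt_eqF.
rewrite -powR_mulrn ?sqnorm_ge0// -powR12_sqrt ?sqnorm_ge0//.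
by rewrite -powRD ?s0 ?implybT// m1; congr (_ `^ _); field.
Qed.

(** Also valid at x = y, where the factor (x - y) makes both sides vanish; the
    flux can therefore be replaced by this radial field inside a derivative. *)
Lemma plaplacian_flux a b p m x y i : 0 < b -> (0 < m)%N ->
  let v := grad (fun z => a + b * sqnorm (z - y) ^+ m) x in
  enorm v `^ (p - 2) * v 0 i =
  (2 * m%:R * b) `^ (p - 1) *
    sqnorm (x - y) `^ (((2 * m%:R - 1) * (p - 1) - 1) / 2) * (x - y) 0 i.
Proof.
move=> b0 m0 /=.
have [xy0|xy0] := eqVneq (x - y) 0.
  by rewrite grad_sqdist_exp xy0 scaler0 !mxE !mulr0.
rewrite enorm_grad_sqdist_exp ?ltW// grad_sqdist_exp.
set s := sqnorm (x - y); set c := 2 * _ * b.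
have s0 : 0 < s by rewrite lt_def sqnorm_ge0 sqnorm_eq0 xy0.
have c0 : 0 < c by rewrite !mulr_gt0// ltr0n.
clearbody c s; rewrite [((c * s ^+ m.-1) *: (x - y)) 0 i]mxE !mulrA; congr (_ * _).
rewrite powRM ?powR_ge0 ?ltW// -powRrM.
rewrite -[s ^+ _]powR_mulrn ?ltW// -[LHS]mulrA mulrACA.
rewrite -[X in _ `^ _ * X * _](powRr1 (ltW c0)).
rewrite -!powRD ?(gt_eqF c0) ?(gt_eqF s0) ?implybT//.
have -> : m.-1%:R = m%:R - 1 :> R by rewrite -subn1 natrB.
by congr (_ `^ _ * _ `^ _); field.
Qed.

(** The flux is K s^e (x - y) with s = |x - y|^2, whose divergence is
    K (N + 2e) s^e. At the center this requires a flux that is differentiable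
    there, which holds for p = 2, the only case where the center is needed. *)
Lemma plaplacian_sqdist_exp a b p m x y :
  0 < b -> (1 < m)%N -> x != y \/ p = 2 ->
  plaplacian p (fun z => a + b * sqnorm (z - y) ^+ m) x =
  (2 * m%:R * b) `^ (p - 1) * (N%:R - 1 + (2 * m%:R - 1) * (p - 1)) *
    sqnorm (x - y) `^ (((2 * m%:R - 1) * (p - 1) - 1) / 2).
Proof.
move=> b0 m1 xyp; rewrite /plaplacian.
set K := _ `^ (p - 1); set e := (_ - 1) / 2.
under eq_bigr => i _.
  under eq_fun => z do rewrite (plaplacian_flux a p z y i b0 (ltnW m1)) -/K -/e.
  over.
have [xy|xy] := eqVneq x y; last first.
  have s0 : 0 < sqnorm (x - y).
    by rewrite lt_def sqnorm_ge0 sqnorm_eq0 subr_eq0 xy.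
  rewrite (divergence_radial
    (is_deriveZ (f := fun t => t `^ e) K (is_derive1_powR e s0))).
  rewrite /= /GRing.scale /= powRB ?(gt_eqF s0) ?implybT// powRr1 ?ltW//.
  by rewrite /e; field; rewrite gt_eqF.
have {xyp} p2 : p = 2 by case: xyp => //; rewrite xy eqxx.
(* Real powers of s are in general not differentiable at s = 0 on the line; for p = 2 the exponent e is a natural number. *)
have eE : e = m.-1%:R by rewrite /e p2 -subn1 natrB ?(ltnW m1)//; field.
under eq_bigr => i _.
  under eq_fun => z do rewrite eE powR_mulrn ?sqnorm_ge0//.
  over.
rewrite (divergence_radial
  (is_deriveZ K (is_derive1_expn m.-1 (sqnorm (x - y))))).
have -> : sqnorm (x - y) = 0 by apply/eqP; rewrite sqnorm_eq0 xy subrr.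
have z0 : 0 ^+ m.-1 = 0 :> R.
  by rewrite expr0n; case: (m) m1 => [|[]].
rewrite mulr0 mul0r addr0 eE powR_mulrn// z0 mulr0.
transitivity (N%:R * (K * 0 ^+ m.-1)); first by [].
by rewrite z0 !mulr0.
Qed.

End PLaplacian.

(** * Test functions *)

Section TestFunctions.
Context {R : realType} {N : nat}.
Implicit Types (b p q : R) (m n : nat) (c y : 'rV[R]_N) (z : R * 'rV[R]_N).

(** Here |f'|^(p-2) f'' is a multiple of r^((n-1)(p-1)-1), so the last
    hypothesis is what makes it tend to 0. *)
Lemma class_F_expn p b n : 0 < b -> (2 < n)%N -> 1 < (n%:R - 1) * (p - 1) ->
  class_F p (fun r => b * r ^+ n).
Proof.
move=> b0 n2 np.
have D k (a : R) : derive1 (fun r => a * r ^+ k) = fun r => a * k%:R * r ^+ k.-1.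
  apply/funext => r; rewrite derive1E.
  have [_ ->] := is_deriveZ a (is_derive1_expn k r).
  by rewrite /GRing.scale /= mulrA.
have D2 : derive1n 2 (fun r => b * r ^+ n) =
    fun r => b * n%:R * n.-1%:R * r ^+ n.-2.
  by rewrite /derive1n /= !D.
have n0 : (0 < n)%N by case: (n) n2.
have n1 : (0 < n.-1)%N by case: (n) n2 => [|[]].
have nn2 : (0 < n.-2)%N by case: (n) n2 => [|[|[]]].
have z k : (0 < k)%N -> 0 ^+ k = 0 :> R by case: k => // k _; rewrite expr0n.
split.
- apply: polyfun_Ck; apply: polyfun_mul; first exact: polyfun_cst.
  apply: polyfun_exp; apply: (@polyfun_lin _ _ (id : R -> R^o)) => // r.
  exact: cvg_id.
- by rewrite D2 D !z// !mulr0.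
- by move=> r r0; rewrite D2 !mulr_gt0 ?ltr0n// exprn_gt0.
- rewrite D2 D.
  pose e := (n%:R - 1) * (p - 1) - 1.
  pose K := (b * n%:R) `^ (p - 2) * (b * n%:R * n.-1%:R).
  have : K * r `^ e @[r --> 0^'+] --> K * 0.
    by apply: cvgMr; apply: powR_cvg0; rewrite subr_gt0.
  rewrite mulr0; apply: cvg_trans; apply: near_eq_cvg.
  near=> r.
  have r0 : 0 < r by near: r; exact: nbhs_right_gt.
  have bn0 : 0 <= b * n%:R by exact: mulr_ge0 (ltW b0) (ler0n _ _).
  have rn0 k : 0 <= r ^+ k by rewrite exprn_ge0// ltW.
  rewrite ger0_norm ?(mulr_ge0 bn0)// powRM//.
  rewrite -!powR_mulrn ?(ltW r0)// -powRrM.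
  rewrite /K /= mulrACA -powRD ?(gt_eqF r0) ?implybT//; congr (_ * _ `^ _).
  rewrite -[n.-2]subn2 -subn1 !natrB ?(ltnW n2)// /e; ring.
Unshelve. all: by end_near. Qed.

(** The square in time separates the touching time t0 from the others without
    changing the time derivative at t0. *)
Definition barrier (k b kappa t0 : R) m c z : R :=
  k + kappa * z.1 + (z.1 - t0) ^+ 2 + b * sqnorm (z.2 - c) ^+ m.

Lemma polyfun_time : polyfun (fun z : R * 'rV[R]_N => z.1).
Proof.
apply: (@polyfun_lin _ _ (fun z : R * 'rV[R]_N => z.1 : R^o)) => //.
by move=> z; exact: cvg_fst.
Qed.

Lemma polyfun_space c m :
  polyfun (fun z : R * 'rV[R]_N => sqnorm (z.2 - c) ^+ m).
Proof.
apply: polyfun_exp.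
apply: (polyfun_comp_linear (l := fun z : R * 'rV[R]_N => z.2)
  (f := fun x => sqnorm (x - c))) => //.
- by move=> z; exact: cvg_snd.
- exact: polyfun_sqdist.
Qed.

Lemma barrier_Ck2 k b kappa t0 m c D : Ck 2 D (barrier k b kappa t0 m c).
Proof.
have pt := polyfun_time; apply: polyfun_Ck; apply: polyfun_add.
  apply: polyfun_add.
    apply: polyfun_add; first exact: polyfun_cst.
    by apply: polyfun_mul => //; exact: polyfun_cst.
  by apply: polyfun_exp; apply: polyfun_add => //; exact: polyfun_cst.
by apply: polyfun_mul; [exact: polyfun_cst|exact: polyfun_space].
Qed.

Lemma gradx_barrier k b kappa t0 m c z :
  gradx (barrier k b kappa t0 m c) z =
  (2 * m%:R * b * sqnorm (z.2 - c) ^+ m.-1) *: (z.2 - c).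
Proof.
exact: (grad_sqdist_exp (k + kappa * z.1 + (z.1 - t0) ^+ 2) b m z.2 c).
Qed.

Lemma dt_barrier k b kappa t0 m c z :
  dt (barrier k b kappa t0 m c) z = kappa + 2 * (z.1 - t0).
Proof.
rewrite /dt derive1E /barrier /=; move: (b * _) => B.
rewrite (_ : (fun s : R => _) =
    (id ^+ 2 + (kappa - 2 * t0) *: id + cst (k + t0 ^+ 2 + B) : R -> R)).
  have [_ ->] := is_deriveD (is_deriveD (is_deriveX 2 (is_derive_id z.1 (1 : R)))
    (is_deriveZ (kappa - 2 * t0) (is_derive_id z.1 (1 : R))))
    (is_derive_cst (k + t0 ^+ 2 + B : R) z.1 1).
  by rewrite expr1 /GRing.scale /=; ring.
by apply/funext => s; rewrite !fctE /GRing.scale /=; ring.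
Qed.

(** The center c is the only point where the spatial gradient vanishes. Around
    a critical point (t1, c), the function differs from its first order
    expansion in time by exactly b |x - c|^(2m) + (t - t1)^2, the form that
    flatness requires. *)
Lemma barrier_admissible p k b kappa t0 m c :
  0 < b -> (1 < m)%N -> 1 < (2 * m%:R - 1) * (p - 1) ->
  admissible p (barrier k b kappa t0 m c).
Proof.
move=> b0 m1 mp; split; first exact: barrier_Ck2.
move=> _ z0 _; rewrite gradx_barrier => g0.
have z0c : sqnorm (z0.2 - c) = 0.
  move/eqP: g0; rewrite scaler_eq0 !mulf_eq0 expf_eq0 !pnatr_eq0 (gt_eqF b0).
  rewrite (gtn_eqF (ltnW m1)) /= andbC.
  by case/orP => [/andP[/eqP->]//|]; rewrite -sqnorm_eq0 => /eqP.
have z0E : z0.2 = c by apply/eqP; rewrite -subr_eq0 -sqnorm_eq0 z0c.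
exists 1, (fun r => b * r ^+ (2 * m)), (fun r => r ^+ 2); split=> //.
- apply: class_F_expn => //; first by rewrite (leq_trans _ (leq_mul (leqnn 2) m1)).
  by rewrite natrM.
- split.
  + by apply: continuous_subspaceT => r; exact: exprn_continuous.
  + by move=> r _; exact: sqr_ge0.
  + apply: (@cvg_trans _ (r @[r --> 0^'+])); last exact: cvg_at_right_filter.
    apply: near_eq_cvg; near=> r.
    have r0 : r != 0 by rewrite gt_eqF//; near: r; exact: nbhs_right_gt.
    by rewrite expr2 mulfK.
- move=> z _ _; rewrite dt_barrier /barrier z0c z0E.
  rewrite exprM enorm_sqr -normrX (ger0_norm (sqr_ge0 _)) expr0n.
  case: (m) m1 => // k' _.
  rewrite [X in `|X|](_ : _ =
      b * sqnorm (z.2 - c) ^+ k'.+1 + (z.1 - z0.1) ^+ 2) /=; last by ring.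
  by rewrite ger0_norm// addr_ge0 ?sqr_ge0// mulr_ge0 ?exprn_ge0 ?sqnorm_ge0// ltW.
Unshelve. all: by end_near. Qed.

End TestFunctions.

(** * The barrier as a supersolution, and the touching argument *)

Section Subsolution.
Context {R : realType} {N : nat}.
Implicit Types (b p q : R) (m n : nat) (c y v w : 'rV[R]_N) (z : R * 'rV[R]_N).

(** The quotient of the p-Laplacian by the absorption term |grad|^q is the
    left-hand side of the smallness hypothesis: diffusion has the extra factor
    s^(((2m-1)(p-1-q)-1)/2), whose exponent is nonnegative by the choice of
    m. *)
Lemma rhs_barrier_le0 p q k b kappa t0 m c z :
  0 < b -> (1 < m)%N -> p <= 2 -> 0 < q ->
  1 <= (2 * m%:R - 1) * (p - 1 - q) ->
  (2 * m%:R * b) `^ (p - 1 - q) * (N%:R - 1 + (2 * m%:R - 1) * (p - 1)) *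
    sqnorm (z.2 - c) `^ (((2 * m%:R - 1) * (p - 1 - q) - 1) / 2) <= 1 ->
  rhs p q (barrier k b kappa t0 m c) z <= 0.
Proof.
move=> b0 m1 p2 q0 mpq small; rewrite /rhs.
case: ifPn => // crit.
have m2 : 2 <= m%:R :> R by rewrite ler_nat.
have zc : z.2 != c \/ p = 2.
  case: (eqVneq z.2 c) => [zc|]; [right|by left].
  move: crit; rewrite gradx_barrier zc subrr scaler0 eqxx andbT -leNgt => p2'.
  by apply/eqP; rewrite eq_le p2.
have gE : enorm (gradx (barrier k b kappa t0 m c) z) =
    2 * m%:R * b * sqnorm (z.2 - c) `^ (m%:R - 2^-1).
  exact: (enorm_grad_sqdist_exp (k + kappa * z.1 + (z.1 - t0) ^+ 2) z.2 c
    (ltW b0) (ltnW m1)).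
have lE : plapx p (barrier k b kappa t0 m c) z =
    (2 * m%:R * b) `^ (p - 1) * (N%:R - 1 + (2 * m%:R - 1) * (p - 1)) *
    sqnorm (z.2 - c) `^ (((2 * m%:R - 1) * (p - 1) - 1) / 2).
  exact: (plaplacian_sqdist_exp (k + kappa * z.1 + (z.1 - t0) ^+ 2) b0 m1 zc).
rewrite gE lE subr_le0 {gE lE crit zc}.
move: small (sqnorm_ge0 (z.2 - c)); set B := 2 * m%:R * b.
set Lam := N%:R - 1 + _; move: (sqnorm _) => s small s0.
have B0 : 0 < B by rewrite !mulr_gt0// (lt_le_trans _ m2).
rewrite powRM ?powR_ge0 ?(ltW B0)// -powRrM.
have -> : p - 1 = (p - 1 - q) + q by ring.
have -> : ((2 * m%:R - 1) * (p - 1 - q + q) - 1) / 2 =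
    ((2 * m%:R - 1) * (p - 1 - q) - 1) / 2 + (m%:R - 2^-1) * q by field.
rewrite [B `^ _]powRD ?(gt_eqF B0) ?implybT// [s `^ _]powRD; last first.
  have h1 : 0 < (m%:R - 2^-1) * q by rewrite mulr_gt0//; lra.
  have h2 : 0 <= ((2 * m%:R - 1) * (p - 1 - q) - 1) / 2.
    by rewrite divr_ge0// subr_ge0.
  by rewrite (gt_eqF (ltr_wpDl h2 h1)).
rewrite (_ : _ * _ = ((B `^ (p - 1 - q) * Lam) *
  s `^ (((2 * m%:R - 1) * (p - 1 - q) - 1) / 2)) *
  (B `^ q * s `^ ((m%:R - 2^-1) * q))); last by ring.
by rewrite ler_piMl// mulr_ge0// powR_ge0.
Qed.

(** The power mean inequality; the inductive step is the correlation
    inequality (a - b)(a^k - b^k) >= 0. *)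
Lemma ler_expn_mean n (a b : R) : 0 <= a -> 0 <= b ->
  (a + b) ^+ n.+1 <= 2 ^+ n * (a ^+ n.+1 + b ^+ n.+1).
Proof.
move=> a0 b0; elim: n => [|n IH]; first by rewrite !expr1 mul1r.
rewrite exprS (le_trans (ler_wpM2l (addr_ge0 a0 b0) IH))// mulrCA.
rewrite [2 ^+ n.+1]exprSr -mulrA ler_pM2l ?exprn_gt0//.
rewrite [a ^+ n.+2]exprS [b ^+ n.+2]exprS -subr_ge0.
rewrite (_ : _ - _ = (a - b) * (a ^+ n.+1 - b ^+ n.+1)); last by ring.
have [ab|ab] := leP a b.
  by rewrite mulr_le0// subr_le0// lerXn2r.
by rewrite mulr_ge0// subr_ge0 ?lerXn2r// ltW.
Qed.

(** Strict midpoint convexity of |.|^(2m): the parallelogram identity supplies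
    the strictness, and the power mean inequality the rest. *)
Lemma sqnorm_exp_convex m v w : (0 < m)%N -> v != w ->
  sqnorm (v + w) ^+ m < 4 ^+ m / 2 * (sqnorm v ^+ m + sqnorm w ^+ m).
Proof.
case: m => // m _ vw.
have v0 := sqnorm_ge0 v; have w0 := sqnorm_ge0 w.
have vw0 : 0 < sqnorm (v - w).
  by rewrite lt_def sqnorm_ge0 sqnorm_eq0 subr_eq0 vw.
apply: (@lt_le_trans _ _ ((2 * (sqnorm v + sqnorm w)) ^+ m.+1)).
  rewrite ltrXn2r ?sqnorm_ge0//.
  by rewrite -sqnorm_parallelogram ltrDl.
rewrite exprMn (le_trans (ler_wpM2l _ (ler_expn_mean m v0 w0))) ?exprn_ge0//.
have -> : 4 = 2 * 2 :> R by ring.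
rewrite exprMn [X in _ <= _ * X / _ * _]exprS mulrA.
by rewrite le_eqVlt; apply/orP; left; apply/eqP; field.
Qed.

Lemma compact_sqball c (r : R) : compact [set x | sqnorm (x - c) <= r].
Proof.
have box : compact
    [set v : 'rV[R]_N | forall i, `[c 0 i - (1 + r), c 0 i + (1 + r)]%classic (v 0 i)].
  apply: (rV_compact (A := fun i => `[c 0 i - (1 + r), c 0 i + (1 + r)]%classic)) => i.
  exact: segment_compact.
apply: subclosed_compact box _.
  apply: (preimage_closed _ (@closed_le _ r)) => x _.
  by apply: polyfun_continuous; exact: polyfun_sqdist.
move=> x /= xr i; rewrite in_itv /= -ler_distl.
have xi : `|x 0 i - c 0 i| ^+ 2 <= r.
  rewrite real_normK ?num_real// (le_trans _ xr)// /sqnorm (bigD1 i)//=.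
  by rewrite !mxE lerDl sumr_ge0// => j _; exact: sqr_ge0.
(* a^2 <= r implies a <= 1 + r because 2a <= a^2 + 1. *)
have := sqr_ge0 (`|x 0 i - c 0 i| - 1); nra.
Qed.

Lemma exists_max_halfspace (f : R * 'rV[R]_N -> R) (T r : R) c z1 :
  {within [set z | 0 <= z.1], continuous f} ->
  (forall z, 0 <= z.1 -> 0 < f z -> z.1 <= T /\ sqnorm (z.2 - c) <= r) ->
  0 <= z1.1 -> 0 < f z1 ->
  exists z0, [/\ 0 <= z0.1, 0 < f z0 & forall z, 0 <= z.1 -> f z <= f z0].
Proof.
move=> cf fle z1ge fz1.
pose A : set (R * 'rV[R]_N) := `[0, T] `*` [set x | sqnorm (x - c) <= r].
have Az z : 0 <= z.1 -> 0 < f z -> A z.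
  by move=> z0 fz; have [zT zr] := fle z z0 fz; split => //=; rewrite in_itv /= z0.
have A0 : A !=set0 by exists z1; exact: Az.
have cA : compact A.
  apply: compact_setX; first exact: segment_compact.
  exact: compact_sqball.
have cAf : {within A, continuous f}.
  apply: continuous_subspaceW cf => z [] /=.
  by rewrite in_itv /= => /andP[].
have [z0 /set_mem z0A z0max] := compact_EVT_max A0 cA cAf.
have fz0 : 0 < f z0 by rewrite (lt_le_trans fz1)// z0max// mem_set//; exact: Az.
exists z0; split => //.
  by case: z0A; rewrite /= in_itv /= => /andP[].
move=> z z0'; have [fz|fz] := leP (f z) 0; first by rewrite (le_trans fz)// ltW.
by apply: z0max; rewrite mem_set//; exact: Az.
Qed.

End Subsolution.

Section Vanishing.
Context {R : realType} {N : nat}.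
Implicit Types (u : R -> 'rV[R]_N -> R) (y : 'rV[R]_N).

(** A bounded subsolution vanishes at y for all times if it is nonpositive at
    time 0 in a ball around y on which C |x - y|^(2m), with C = M / L^(2m), is
    a supersolution. This value of C is the one for which the barrier reaches
    the bound M of u exactly on the boundary of the ball. *)
Lemma subsolution_vanishes p q u m M L y :
  1 < p -> p <= 2 -> 0 < q -> (1 < m)%N ->
  1 <= (2 * m%:R - 1) * (p - 1 - q) ->
  {within [set z : R * 'rV[R]_N | 0 <= z.1], continuous (fun z => u z.1 z.2)} ->
  viscosity_subsolution p q u ->
  0 < M -> (forall t x, 0 <= t -> u t x <= M) ->
  0 < L -> (forall x, sqnorm (x - y) < L ^+ 2 -> u 0 x <= 0) ->
  (forall s, 0 <= s <= L ^+ 2 ->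
    (m%:R * 4 ^+ m * (M / (L ^+ 2) ^+ m)) `^ (p - 1 - q) *
    (N%:R - 1 + (2 * m%:R - 1) * (p - 1)) *
    s `^ (((2 * m%:R - 1) * (p - 1 - q) - 1) / 2) <= 1) ->
  forall t, 0 <= t -> u t y <= 0.
Proof.
move=> p1 p2 q0 m1 mpq cu sub M0 uM L0 u0 small t t0.
rewrite leNgt; apply/negP => uty.
have m0 : (0 < m)%N := ltnW m1.
set C := M / (L ^+ 2) ^+ m in small.
have C0 : 0 < C by rewrite divr_gt0// !exprn_gt0.
have CL : C * (L ^+ 2) ^+ m = M by rewrite divfK// gt_eqF// !exprn_gt0.
pose b := C * (4 ^+ m / 2).
have b0 : 0 < b by rewrite mulr_gt0// divr_gt0// exprn_gt0.
(* The slope keeps kappa t below u(t, y), so that w below is positive at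
   (t, y). *)
pose kappa := u t y / (2 * (t + 1)).
have t1 : 0 < t + 1 by rewrite ltr_wpDl.
have kappa0 : 0 < kappa by rewrite divr_gt0// mulr_gt0.
pose w (z : R * 'rV[R]_N) :=
  u z.1 z.2 - (kappa * z.1 + C * sqnorm (z.2 - y) ^+ m).
have cw : {within [set z | 0 <= z.1], continuous w}.
  have pg : polyfun (fun z : R * 'rV[R]_N => kappa * z.1 + C * sqnorm (z.2 - y) ^+ m).
    apply: polyfun_add; apply: polyfun_mul;
      [exact: polyfun_cst|exact: polyfun_time|exact: polyfun_cst|].
    exact: polyfun_space.
  have cg : {within [set z : R * 'rV[R]_N | 0 <= z.1],
      continuous (fun z => kappa * z.1 + C * sqnorm (z.2 - y) ^+ m)}.
    by apply: continuous_subspaceT; exact: polyfun_continuous pg.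
  by move=> z; exact: cvgB (cu z) (cg z).
have inside z : 0 <= z.1 -> 0 < w z ->
    z.1 <= M / kappa /\ sqnorm (z.2 - y) < L ^+ 2.
  move=> z0; rewrite subr_gt0 => /lt_le_trans/(_ (uM _ _ z0)) wM.
  have c1 : 0 <= kappa * z.1 by rewrite mulr_ge0// ltW.
  have c2 : 0 <= C * sqnorm (z.2 - y) ^+ m.
    by rewrite mulr_ge0 ?exprn_ge0 ?sqnorm_ge0// ltW.
  split; first by rewrite ler_pdivlMr// mulrC; lra.
  rewrite -(ltr_pXn2r m0) ?nnegrE ?sqnorm_ge0 ?sqr_ge0// -(ltr_pM2l C0) CL.
  lra.
have wty : 0 < w (t, y).
  have s0 : sqnorm (y - y) = 0 by apply/eqP; rewrite sqnorm_eq0 subrr.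
  rewrite /w /= s0 expr0n (gtn_eqF m0) mulr0 addr0 subr_gt0 /kappa.
  rewrite mulrAC ltr_pdivrMr ?mulr_gt0// ltr_pM2l//; lra.
have [z0 [z00 wz0 wmax]] := exists_max_halfspace (z1 := (t, y)) cw
  (fun z z0 wz => conj (inside z z0 wz).1 (ltW (inside z z0 wz).2)) t0 wty.
have [_ z0L] := inside z0 z00 wz0.
have z0pos : 0 < z0.1.
  rewrite lt_def z00 andbT; apply/eqP => z01.
  move: wz0; rewrite ltNge /w z01 mulr0 add0r => /negP; apply.
  rewrite subr_le0 (le_trans (u0 _ z0L))// mulr_ge0 ?exprn_ge0 ?sqnorm_ge0//.
  exact: ltW.
(* V is half of x0 - y, and y + V is the midpoint y' of x0 and y. *)
pose V := 2^-1 *: (z0.2 - y).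
have VV : z0.2 - y = V + V.
  by rewrite -mulr2n -scaler_nat scalerA divff// scale1r.
have yV : z0.2 - (y + V) = V by rewrite opprD addrA VV addrK.
pose psi := barrier (w z0 + b * sqnorm V ^+ m) b kappa z0.1 m (y + V).
have CVV : C * sqnorm (V + V) ^+ m = b * sqnorm V ^+ m + b * sqnorm V ^+ m.
  rewrite -mulr2n -scaler_nat sqnormZ exprMn (_ : 2 ^+ 2 = 4); last by ring.
  by rewrite /b; field.
have psiz0 : u z0.1 z0.2 = psi z0.
  rewrite /psi /barrier yV subrr expr0n /= addr0 /w VV CVV; ring.
have touch z : Qinfty z -> z <> z0 -> u z.1 z.2 < psi z.
  move=> z1 zz0.
  have := wmax z (ltW z1); rewrite {1}/w lerBlDr => /le_lt_trans; apply.
  rewrite /psi /barrier.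
  have -> : z.2 - y = (z.2 - (y + V)) + V by rewrite opprD addrA subrK.
  (* Convexity is strict away from x0; above x0 the square in time decides. *)
  have [xV|xV] := eqVneq (z.2 - (y + V)) V.
    rewrite xV CVV.
    have : 0 < (z.1 - z0.1) ^+ 2.
      rewrite lt_def sqr_ge0 andbT sqrf_eq0 subr_eq0; apply/eqP => tt; apply: zz0.
      rewrite [z]surjective_pairing [z0]surjective_pairing tt; congr pair.
      by move: xV; rewrite -{2}yV => /addIr.
    lra.
  have cvx : C * sqnorm (z.2 - (y + V) + V) ^+ m <
      b * (sqnorm (z.2 - (y + V)) ^+ m + sqnorm V ^+ m).
    by rewrite /b -[ltRHS]mulrA ltr_pM2l// sqnorm_exp_convex.
  have := sqr_ge0 (z.1 - z0.1); lra.
have adm : admissible p psi.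
  apply: barrier_admissible => //.
  apply: (le_lt_trans mpq); rewrite ltr_pM2l; first by lra.
  have : 2 <= m%:R :> R by rewrite ler_nat.
  lra.
have := sub psi z0 adm z0pos psiz0 touch.
rewrite dt_barrier subrr mulr0 addr0 leNgt => /negP; apply.
apply: (le_lt_trans _ kappa0); apply: rhs_barrier_le0 => //.
rewrite yV (_ : 2 * m%:R * b = m%:R * 4 ^+ m * C); last by rewrite /b; field.
apply: small; rewrite sqnorm_ge0 /= sqnormZ.
have := sqnorm_ge0 (z0.2 - y); lra.
Qed.

End Vanishing.

(** * Finite extent of the positivity set *)

(** The scaling behind the choice of L: the first factor carries
    L^(-2m theta), the last one at most L^((2m-1) theta - 1), and their
    product L^(-theta-1) <= L^(-1) compensates the constant A^theta Lam. *)
Lemma absorption_scale (R : realType) (theta A Lam L s : R) (m : nat) :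
  0 < theta -> 1 <= (2 * m%:R - 1) * theta -> 0 <= A -> 0 <= Lam ->
  1 <= L -> A `^ theta * Lam <= L -> 0 <= s <= L ^+ 2 ->
  (A / (L ^+ 2) ^+ m) `^ theta * Lam * s `^ (((2 * m%:R - 1) * theta - 1) / 2)
  <= 1.
Proof.
move=> th0 mth A0 Lam0 L1 AL /andP[s0 sL].
have L0 : 0 < L := lt_le_trans ltr01 L1.
set sigma := (_ - 1) / 2.
have sg0 : 0 <= sigma by rewrite divr_ge0// subr_ge0.
have sE : s `^ sigma <= L `^ (2 * sigma).
  rewrite [L `^ _]powRrM (powR_mulrn 2) ?(ltW L0)//.
  by rewrite ge0_ler_powR ?nnegrE ?sqr_ge0.
have AE : (A / (L ^+ 2) ^+ m) `^ theta = A `^ theta * L `^ (- (2 * m%:R * theta)).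
  rewrite powRM ?invr_ge0 ?exprn_ge0 ?(ltW L0)// -exprM -powR_mulrn ?(ltW L0)//.
  by rewrite -powRN -powRrM natrM mulNr.
apply: (@le_trans _ _ (A `^ theta * Lam * L `^ (- (theta + 1)))).
  have -> : - (theta + 1) = - (2 * m%:R * theta) + 2 * sigma.
    by rewrite /sigma; field.
  rewrite [L `^ _]powRD ?(gt_eqF L0) ?implybT// mulrA AE.
  rewrite [A `^ _ * _ * _]mulrAC ler_wpM2l//.
  by rewrite !mulr_ge0 ?powR_ge0.
have LL : L `^ (- (theta + 1)) <= L^-1.
  by rewrite -powR_inv1 ?(ltW L0)// ler_powR//; lra.
apply: (le_trans (ler_wpM2l _ LL)); first by rewrite mulr_ge0 ?powR_ge0.
by rewrite ler_pdivrMr// mul1r.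
Qed.

Theorem proposition4p2 (R : realType) (N : nat) (p q : R)
    (u0 : 'rV[R]_N -> R) (u : R -> 'rV[R]_N -> R) :
  (1 <= N)%N ->
  2 * N%:R / (N%:R + 1) < p -> p <= 2 ->
  0 < q -> q < p - 1 ->
  W1infty u0 ->
  (forall x, 0 <= u0 x) -> (exists x, u0 x != 0) ->
  compactly_supported u0 ->
  is_solution p q u0 u ->
  exists2 r : R, 0 < r &
    forall t : R, 0 <= t -> positivity_set u t `<=` eball 0 r.
Proof.
move=> N1 _ p2 q0 qp _ _ [x0 u0x0] supp [[cu [B uB]] _ _ [sub _] uinit].
have theta0 : 0 < p - 1 - q by rewrite subr_gt0.
have p1 : 1 < p by rewrite -subr_gt0 (lt_trans q0).
(* With m >= 1/theta + 2 for theta = p - 1 - q, both m >= 2 and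
   (2m - 1) theta >= 1 hold. *)
pose m := (Num.bound (p - 1 - q)^-1).+2.
have mbound : (p - 1 - q)^-1 + 2 <= m%:R.
  rewrite (natrD _ 2 (Num.bound _)) addrC lerD2l ltW// archi_boundP// invr_ge0 ltW//.
have thV : 0 < (p - 1 - q)^-1 by rewrite invr_gt0.
have mth : 1 <= (2 * m%:R - 1) * (p - 1 - q).
  by rewrite -ler_pdivrMr// div1r; lra.
pose M := `|B| + 1.
have M0 : 0 < M by rewrite ltr_wpDl.
have uM t x : 0 <= t -> u t x <= M.
  move=> t0; rewrite (le_trans (ler_norm _))// (le_trans (uB _ x t0))//.
  by rewrite (le_trans (ler_norm _))// lerDl.
have N1R : 1 <= N%:R :> R by rewrite ler1n.
pose A := m%:R * 4 ^+ m * M.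
pose Lam := N%:R - 1 + (2 * m%:R - 1) * (p - 1).
have A0 : 0 <= A by rewrite mulr_ge0 ?(ltW M0)// mulr_ge0 ?exprn_ge0.
have Lam0 : 0 <= Lam.
  by rewrite addr_ge0 ?subr_ge0// mulr_ge0 ?subr_ge0 ?ltW//; lra.
pose L := A `^ (p - 1 - q) * Lam + 1.
have L1 : 1 <= L.
  rewrite /L lerDr. exact: mulr_ge0 (powR_ge0 _ _) Lam0.
have L0 : 0 < L := lt_le_trans ltr01 L1.
have [c _ cmax] := compact_EVT_max
  (ex_intro _ x0 (subset_closure (u0x0 : [set x | u0 x != 0] x0))) supp
  (continuous_subspaceT (polyfun_continuous (polyfun_sqdist 0))).
(* The support of u0 lies in |x|^2 <= |c|^2. By the parallelogram identity
   |y|^2 <= 2 |x|^2 + 2 |x - y|^2, so the ball of radius L around y misses the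
   support as soon as |y|^2 >= r. *)
pose r := 1 + 2 * sqnorm (c - 0) + 2 * L ^+ 2.
have r1 : 1 <= r.
  have := sqnorm_ge0 (c - 0); have := sqr_ge0 L; rewrite /r; lra.
exists r; first exact: lt_le_trans r1.
move=> t t0 y; rewrite /positivity_set /eball /= => uty; rewrite ltNge; apply/negP => ry.
have yr : r <= sqnorm y.
  move: ry; rewrite subr0 => ry.
  rewrite -enorm_sqr (le_trans ry)// expr2 ler_peMl ?enorm_ge0//.
  exact: le_trans ry.
move: uty; rewrite /positivity_set /= ltNge => /negP; apply.
apply: (subsolution_vanishes p1 p2 q0 (m := m) (M := M) (L := L)) => //.
  move=> x xy; rewrite uinit leNgt; apply/negP => u0x.
  have xc : sqnorm (x - 0) <= sqnorm (c - 0).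
    by apply/cmax/mem_set/subset_closure; rewrite /= gt_eqF.
  have := sqnorm_parallelogram x (x - y); rewrite subKr.
  have := sqnorm_ge0 (x + (x - y)); move: xc; rewrite subr0.
  move: yr; rewrite /r; lra.
move=> s sL; rewrite mulrA; apply: absorption_scale => //.
by rewrite /L lerDl.
Qed.
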